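(* Let $G$ be a finite simple graph and let $K_m$ be the complete graph on $m$ vertices (with vertex set disjoint from that of $G$). Then $$H_{\mathbb{K}[G*K_m]}(t)=H_{\mathbb{K}[G]}(t)+m\frac{t}{1-t}.$$
   Context: $\mathbb{K}$ is a field. For a finite simple graph $G$ with vertex set $V(G)=\{x_1,\dots,x_n\}$, the edge ring is $\mathbb{K}[G]=\mathbb{K}[x_1,\dots,x_n]/I(G)$, where $I(G)$ is generated by the monomials $x_ix_j$ with $\{x_i,x_j\}\in E(G)$. $H_{\mathbb{K}[G]}(t)$ denotes its Hilbert series with respect to the standard grading. For graphs $G,H$ with $V(G)\cap V(H)=\emptyset$, the product $G*H$ is the graph on $V(G)\cup V(H)$ with edge set $E(G)\cup E(H)\cup\{\{x,y\}\mid x\in V(G),\ y\in V(H)\}$. *)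

(* Defs.v *)
From HB Require Import structures.
From mathcomp Require Import all_boot all_order all_algebra.
From mathcomp Require Import boolp mpoly.

Set Implicit Arguments.
Unset Strict Implicit.
Unset Printing Implicit Defensive.

Import GRing.Theory.
Local Open Scope ring_scope.
Local Open Scope quotient_scope.

Record fps (R : Type) := Fps { fps_coef : nat -> R }.

HB.instance Definition _ (R : Type) := gen_eqMixin (fps R).
HB.instance Definition _ (R : Type) := gen_choiceMixin (fps R).

Lemma fpsP (R : Type) (f g : fps R) : fps_coef f =1 fps_coef g <-> f = g.
Proof. by split=> [|-> //]; case: f g => [f] [g] /= /funext ->. Qed.

Section FpsRing.
Variable R : comNzRingType.
Implicit Types f g h : fps R.

Definition fps_zero : fps R := Fps (fun _ => 0).
Definition fps_opp f : fps R := Fps (fun n => - fps_coef f n).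
Definition fps_add f g : fps R := Fps (fun n => fps_coef f n + fps_coef g n).

Fact fps_addA : associative fps_add.
Proof. by move=> f g h; apply/fpsP => n /=; rewrite addrA. Qed.
Fact fps_addC : commutative fps_add.
Proof. by move=> f g; apply/fpsP => n /=; rewrite addrC. Qed.
Fact fps_add0 : left_id fps_zero fps_add.
Proof. by move=> f; apply/fpsP => n /=; rewrite add0r. Qed.
Fact fps_addN : left_inverse fps_zero fps_opp fps_add.
Proof. by move=> f; apply/fpsP => n /=; rewrite addNr. Qed.

HB.instance Definition _ :=
  GRing.isZmodule.Build (fps R) fps_addA fps_addC fps_add0 fps_addN.

Definition fps_one : fps R := Fps (fun n => (n == 0%N)%:R).
Definition fps_mul f g : fps R :=
  Fps (fun n => \sum_(i < n.+1) fps_coef f i * fps_coef g (n - i)%N).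

Let trunc n f : {poly R} := \poly_(i < n.+1) fps_coef f i.

Let coef_trunc n f i : (i <= n)%N -> (trunc n f)`_i = fps_coef f i.
Proof. by move=> le_in; rewrite coef_poly ltnS le_in. Qed.

Let mul_trunc n f g i : (i <= n)%N ->
  fps_coef (fps_mul f g) i = (trunc n f * trunc n g)`_i.
Proof.
move=> le_in; rewrite coefM /=; apply: eq_bigr => j _.
by rewrite !coef_trunc // (leq_trans _ le_in) ?leq_subr // -ltnS.
Qed.

Fact fps_mulC : commutative fps_mul.
Proof.
by move=> f g; apply/fpsP => n; rewrite !(mul_trunc _ _ (leqnn n)) mulrC.
Qed.

Fact fps_mulA : associative fps_mul.
Proof.
move=> f g h; apply/fpsP => n.
transitivity (trunc n f * (trunc n g * trunc n h))`_n.
  rewrite coefM /=; apply: eq_bigr => i _.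
  by rewrite coef_trunc -1?ltnS // -mul_trunc ?leq_subr.
rewrite mulrA coefM /=; apply: eq_bigr => i _.
by rewrite coef_trunc ?leq_subr // -mul_trunc // -ltnS.
Qed.

Fact fps_mul1 : left_id fps_one fps_mul.
Proof.
move=> f; apply/fpsP => n /=; rewrite big_ord_recl /= mul1r subn0.
by rewrite big1 ?addr0 // => i _; rewrite mul0r.
Qed.

Fact fps_mulDl : left_distributive fps_mul fps_add.
Proof.
move=> f g h; apply/fpsP => n /=; rewrite -big_split /=.
by apply: eq_bigr => i _; rewrite mulrDl.
Qed.

Fact fps_one_neq0 : fps_one != 0.
Proof. by apply/eqP => /fpsP /(_ 0%N) /eqP; rewrite /= oner_eq0. Qed.

HB.instance Definition _ := GRing.Zmodule_isComNzRing.Build (fps R)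
  fps_mulA fps_mulC fps_mul1 fps_mulDl fps_one_neq0.

(* Inverses exist only classically here; outside the units, inversion is the
   identity, as in any unitRingType. *)
Definition fps_unit : {pred fps R} := fun f => `[< exists g, g * f = 1 >].

Definition fps_inv f : fps R :=
  if pselect (exists g, g * f = 1) is left ex_g then sval (cid ex_g) else f.

Fact fps_mulVr : {in fps_unit, left_inverse 1 fps_inv *%R}.
Proof. by move=> f /asboolP uf; rewrite /fps_inv; case: pselect => // ?; case: cid. Qed.
Fact fps_unitP f g : g * f = 1 -> fps_unit f.
Proof. by move=> gf; apply/asboolP; exists g. Qed.
Fact fps_inv_out : {in [predC fps_unit], fps_inv =1 id}.
Proof. by move=> f /asboolP nuf; rewrite /fps_inv; case: pselect. Qed.

HB.instance Definition _ := GRing.ComNzRing_hasMulInverse.Build (fps R)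
  fps_mulVr fps_unitP fps_inv_out.

Definition fpsX : fps R := Fps (fun n => (n == 1%N)%:R).

Lemma fpsXM f n : fps_coef (fpsX * f) n = if n is k.+1 then fps_coef f k else 0.
Proof.
case: n => [|n]; first by rewrite /= big_ord1 mul0r.
rewrite /= 2!big_ord_recl /= mul0r add0r mul1r subSS subn0.
by rewrite big1 ?addr0 // => i _; rewrite mul0r.
Qed.

Lemma geometric_fps : Fps (fun _ => 1) * (1 - fpsX) = 1.
Proof.
rewrite mulrC mulrBl mul1r; apply/fpsP => n.
rewrite -[LHS]/(1 - fps_coef (fpsX * Fps (fun _ => 1)) n) fpsXM.
by case: n => [|n]; rewrite ?subr0 ?subrr.
Qed.

Lemma unit_fps_1X : 1 - fpsX \is a GRing.unit.
Proof. exact: (fps_unitP geometric_fps). Qed.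

End FpsRing.

Arguments fpsX {R}.

Record sgraph (V : finType) := SGraph {
  adj :> rel V;
  adj_sym : ssrbool.symmetric adj;
  adj_irr : irreflexive adj
}.

Definition complete_rel (V : finType) : rel V := fun x y => x != y.

Fact complete_sym (V : finType) : ssrbool.symmetric (@complete_rel V).
Proof. by move=> x y; rewrite /complete_rel eq_sym. Qed.
Fact complete_irr (V : finType) : irreflexive (@complete_rel V).
Proof. by move=> x; rewrite /complete_rel eqxx. Qed.

Definition complete (m : nat) : sgraph 'I_m :=
  SGraph (@complete_sym 'I_m) (@complete_irr 'I_m).

Section Product.
Variables (V W : finType) (G : sgraph V) (H : sgraph W).

Definition gprod_rel : rel (V + W) := fun u v =>
  match u, v with
  | inl x, inl y => G x y
  | inr x, inr y => H x y
  | _, _ => true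
  end.

Fact gprod_sym : ssrbool.symmetric gprod_rel.
Proof. by move=> [x|x] [y|y] //=; apply: adj_sym. Qed.
Fact gprod_irr : irreflexive gprod_rel.
Proof. by move=> [x|x] /=; apply: adj_irr. Qed.

Definition gprod : sgraph (V + W)%type := SGraph gprod_sym gprod_irr.
End Product.

Section EdgeRing.
Variables (K : fieldType) (V : finType) (G : sgraph V).

Local Notation S := {mpoly K[#|V|]}.

(* The variables of S are numbered by the enumeration of V. *)
Definition vvar (x : V) : S := 'X_(enum_rank x).

Definition edge_ideal : {pred S} := fun p =>
  `[< exists c : V -> V -> S,
        p = \sum_x \sum_(y | G x y) c x y * (vvar x * vvar y) >].

Fact edge_ideal_closed : idealr_closed edge_ideal.
Proof.
split.
- apply/asboolP; exists (fun _ _ => 0).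
  by rewrite big1 // => x _; rewrite big1 // => y _; rewrite mul0r.
- apply/asboolP => -[c /(congr1 (meval (fun _ => 0)))]; rewrite meval1.
  rewrite raddf_sum big1 => [/eqP|x _]; first by rewrite oner_eq0.
  rewrite raddf_sum big1 // => y _.
  by rewrite /= !mevalM !mevalXU mulr0 mulr0.
- move=> a _ _ /asboolP[c ->] /asboolP[d ->]; apply/asboolP.
  exists (fun x y => a * c x y + d x y).
  rewrite mulr_sumr -big_split /=; apply: eq_bigr => x _.
  rewrite mulr_sumr -big_split /=; apply: eq_bigr => y _.
  by rewrite mulrDl -!mulrA.
Qed.

HB.instance Definition _ := isIdealr.Build S edge_ideal edge_ideal_closed.

Definition edge_ring : Type := {ideal_quot edge_ideal}.

HB.instance Definition _ := GRing.ComNzRing.on edge_ring.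

Definition edge_pi (p : S) : edge_ring := \pi_{ideal_quot edge_ideal} p.

Fact edge_pi_is_zmod_morphism : zmod_morphism edge_pi.
Proof. exact: (@rmorphB S {ideal_quot edge_ideal} \pi). Qed.
Fact edge_pi_is_monoid_morphism : monoid_morphism edge_pi.
Proof.
split; first exact: (@rmorph1 S {ideal_quot edge_ideal} \pi).
exact: (@rmorphM S {ideal_quot edge_ideal} \pi).
Qed.

HB.instance Definition _ :=
  GRing.isZmodMorphism.Build S edge_ring edge_pi edge_pi_is_zmod_morphism.
HB.instance Definition _ :=
  GRing.isMonoidMorphism.Build S edge_ring edge_pi edge_pi_is_monoid_morphism.

Lemma edge_pi_eq0 p : (edge_pi p == 0) = (p \in edge_ideal).
Proof.
rewrite -[p in RHS]subr0 Quotient.idealrBE /edge_pi.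
by rewrite -(@rmorph0 S {ideal_quot edge_ideal} \pi).
Qed.

Lemma edge_pi_surj (a : edge_ring) : exists p, a = edge_pi p.
Proof. by exists (repr (a : {ideal_quot edge_ideal})); rewrite /edge_pi reprK. Qed.

Definition edge_scale (c : K) (a : edge_ring) : edge_ring := edge_pi c%:MP * a.

Fact edge_scaleA b c a : edge_scale b (edge_scale c a) = edge_scale (b * c) a.
Proof. by rewrite /edge_scale mulrA -rmorphM /= mpolyCM. Qed.
Fact edge_scale1 : left_id 1 edge_scale.
Proof. by move=> a; rewrite /edge_scale mpolyC1 rmorph1 mul1r. Qed.
Fact edge_scaleDr : right_distributive edge_scale +%R.
Proof. by move=> c a b; rewrite /edge_scale mulrDr. Qed.
Fact edge_scaleDl a : {morph edge_scale^~ a : b c / b + c}.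
Proof. by move=> b c; rewrite /edge_scale mpolyCD rmorphD mulrDl. Qed.

HB.instance Definition _ := GRing.Zmodule_isLmodule.Build K edge_ring
  edge_scaleA edge_scale1 edge_scaleDr edge_scaleDl.

Fact edge_scaleAl (c : K) (a b : edge_ring) : c *: (a * b) = (c *: a) * b.
Proof. exact: mulrA. Qed.

HB.instance Definition _ := GRing.Lmodule_isLalgebra.Build K edge_ring edge_scaleAl.

Lemma edge_piZ c p : edge_pi (c *: p) = c *: edge_pi p.
Proof. by rewrite -mul_mpolyC rmorphM. Qed.

HB.instance Definition _ := GRing.isScalable.Build K S edge_ring *:%R edge_pi edge_piZ.

(* Degree-d part of the standard grading: the image of the d-homogeneous
   polynomials. *)
Definition edge_homog (d : nat) : {pred edge_ring} := fun a =>
  `[< exists2 p : S, p \is d.-homog & a = edge_pi p >].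

Fact edge_homog_closed d : submod_closed (edge_homog d).
Proof.
split; first by apply/asboolP; exists 0; rewrite ?raddf0 ?dhomog0.
move=> c _ _ /asboolP[p hp ->] /asboolP[q hq ->]; apply/asboolP.
by exists (c *: p + q); rewrite ?rpredD ?rpredZ // linearP.
Qed.

HB.instance Definition _ d :=
  GRing.isSubmodClosed.Build K edge_ring (edge_homog d) (edge_homog_closed d).

Record edge_comp (d : nat) := EdgeComp {
  edge_comp_val :> edge_ring;
  _ : edge_comp_val \in edge_homog d
}.

HB.instance Definition _ d := [isSub for @edge_comp_val d].
HB.instance Definition _ d := [Choice of edge_comp d by <:].
HB.instance Definition _ d := [SubChoice_isSubLmodule of edge_comp d by <:].

End EdgeRing.

Lemma span_vector_axiom (K : fieldType) (M : lmodType K) (N : nat) (v : 'I_N -> M) :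
  (forall x, exists c : 'I_N -> K, x = \sum_i c i *: v i) ->
  exists n, inhabited (Vector.axiom n M).
Proof.
elim: N v => [|N IHN] v span_v; last first.
  have [free_v|] := pselect (forall c : 'I_N.+1 -> K,
      \sum_i c i *: v i = 0 -> forall i, c i = 0); last first.
    move/existsNP=> [c /not_implyP[c0 /existsNP[i /eqP ci]]].
    apply: (IHN (fun j => v (lift i j))) => x.
    have [e ->] := span_v x.
    have vi : v i = \sum_(j < N) (- (c (lift i j) / c i)) *: v (lift i j).
      move: c0; rewrite (bigD1_ord i) //= => /eqP; rewrite addr_eq0 => /eqP c0.
      rewrite -[v i]scale1r -(mulVf ci) -scalerA c0 scalerN scaler_sumr -sumrN.
      by apply: eq_bigr => j _; rewrite scalerA scaleNr mulrC.
    exists (fun j => e i * (- (c (lift i j) / c i)) + e (lift i j)).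
    rewrite (bigD1_ord i) //= vi scaler_sumr -big_split /=.
    by apply: eq_bigr => j _; rewrite scalerA scalerDl.
  exists N.+1; constructor.
  pose r x : 'rV[K]_N.+1 := \row_i sval (cid (span_v x)) i.
  have rP x : x = \sum_i r x 0 i *: v i.
    rewrite {1}(svalP (cid (span_v x))).
    by apply: eq_bigr => i _; rewrite mxE.
  have rU x (c : 'I_N.+1 -> K) : x = \sum_i c i *: v i -> r x = \row_i c i.
    move=> xc; apply/rowP => i; rewrite [RHS]mxE; apply/eqP; rewrite -subr_eq0.
    apply/eqP; apply: (free_v (fun i => r x 0 i - c i)).
    under eq_bigr do rewrite scalerBl.
    by rewrite sumrB -rP -xc subrr.
  exists r.
    move=> a x y; rewrite (rU _ (fun i => a * r x 0 i + r y 0 i)).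
      by apply/rowP => i; rewrite !mxE.
    rewrite {1}(rP x) {1}(rP y) scaler_sumr -big_split /=.
    by apply: eq_bigr => i _; rewrite scalerA scalerDl.
  exists (fun w : 'rV_N.+1 => \sum_i w 0 i *: v i) => [x|w]; first by rewrite -rP.
  by rewrite (rU _ (fun i => w 0 i)) //; apply/rowP => i; rewrite mxE.
exists 0%N; constructor; exists (fun=> 0).
  by move=> a x y; rewrite scaler0 addr0.
exists (fun=> 0) => [x|w]; last by apply/rowP => -[].
by have [c ->] := span_v x; rewrite big_ord0.
Qed.

Section Hilbert.
Variables (K : fieldType) (V : finType) (G : sgraph V).

Lemma edge_comp_span d : exists (N : nat) (v : 'I_N -> edge_comp K G d),
  forall x, exists c : 'I_N -> K, x = \sum_i c i *: v i.
Proof.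
pose T : finType := 'X_{1..#|V| < d.+1}.
pose w (m : T) : {mpoly K[#|V|]} :=
  if mdeg m == d then 'X_[m] else 0.
have w_homog m : edge_pi G (w m) \in edge_homog d.
  apply/asboolP; exists (w m) => //; rewrite /w.
  by case: ifP => [dm|_]; rewrite ?dhomogX ?dhomog0.
exists #|T|, (fun i => EdgeComp (w_homog (enum_val i))) => -[a ha].
have /asboolP[p hp ap] := ha.
exists (fun i => p@_((enum_val i : T) : 'X_{1..#|V| < d.+1})); apply: val_inj.
rewrite raddf_sum /= ap.
transitivity (\sum_(m : T) edge_pi G (p@_m *: w m)); last first.
  rewrite (reindex_onto enum_val enum_rank) /= => [|m _]; last by rewrite enum_rankK.
  by apply: eq_big => [i|i _]; rewrite ?enum_valK ?eqxx // linearZ.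
rewrite -raddf_sum; congr (edge_pi G _).
have /mpolywE {1}-> : (msize p <= d.+1)%N.
  rewrite msizeE; apply/bigmax_leqP_seq => m mp _.
  by rewrite ltnS; rewrite (dhomog_mf hp mp).
apply: eq_bigr => m _; rewrite /w; case: eqP => // /eqP dm.
by rewrite (dhomog_nemf_coeff hp dm) !scale0r.
Qed.

Fact edge_comp_vect d : exists n, inhabited (Vector.axiom n (edge_comp K G d)).
Proof. by have [N [v /span_vector_axiom]] := edge_comp_span d. Qed.

(* Only the dimension, which does not depend on the chosen coordinates, is used. *)
HB.instance Definition _ d := Lmodule_hasFinDim.Build K (edge_comp K G d)
  (inhabited_witness (svalP (cid (edge_comp_vect d)))).

Definition hilbert_series : fps int :=
  Fps (fun d => (\dim {:edge_comp K G d})%:Z).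

End Hilbert.

(* Main.v *)
Require Import Defs.
From mathcomp Require Import all_boot all_order all_algebra.
From mathcomp Require Import boolp mpoly.

Import GRing.Theory.
Local Open Scope ring_scope.

(** An edge ideal is generated by monomials, so its monomials, together with
    the monomials outside it, split the polynomial ring: the classes of the
    latter form a basis of the edge ring. A monomial lies outside the ideal
    exactly when no edge joins two vertices of its support, that is, when its
    support is a stable set. Hence the Hilbert function of [K[G]] at [d] is the
    number of exponent vectors of total degree [d] with stable support
    ([hilbert_function]).

    In a join every vertex of one factor is adjacent to every vertex of the
    other, so a nonempty stable set lies inside a single factor. In positive
    degree the numbers of monomials with stable support therefore add up
    ([card_stable_exps_gprod]). The nonempty stable sets of a complete graph are
    the singletons, so its monomials with stable support are the pure powers of
    the [m] variables, one for each variable in each positive degree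
    ([card_stable_exps_complete]). In degree [0] only the monomial [1] remains,
    for every graph ([stable_exps0]). So the join with a complete graph adds [m]
    in each positive degree and nothing in degree [0], which is the series
    [m t / (1 - t)]. *)

(** * Monomials with stable support *)

Definition stable {V : finType} (G : sgraph V) (a : V -> nat) : bool :=
  [forall x, forall y, G x y ==> (a x == 0%N) || (a y == 0%N)].

Lemma stableP {V : finType} (G : sgraph V) (a : V -> nat) :
  reflect (forall x y, G x y -> a x != 0%N -> a y = 0%N) (stable G a).
Proof.
apply: (iffP forallP) => [st x y Gxy ax|st x].
  by have /forallP/(_ y) := st x; rewrite Gxy (negPf ax) => /eqP.
apply/forallP => y; apply/implyP => Gxy.
by have [//|/(st x y Gxy) ->] := boolP (a x == 0%N).
Qed.

(** The vertices index the variables only through [enum_rank]; reading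
    exponents at vertices lets the counting forget this numbering. *)
Definition mnm_exp {V : finType} (m : 'X_{1..#|V|}) (x : V) : nat :=
  m (enum_rank x).

Lemma mdeg_mnm_exp (V : finType) (m : 'X_{1..#|V|}) :
  mdeg m = (\sum_x mnm_exp m x)%N.
Proof.
rewrite mdegE (reindex (@enum_rank V)) //=.
by apply: onW_bij; apply: enum_rank_bij.
Qed.

Lemma vvarM (K : fieldType) (V : finType) (x y : V) :
  vvar K x * vvar K y = 'X_[U_(enum_rank x) + U_(enum_rank y)].
Proof. by rewrite mpolyXD. Qed.

(** A multiple of an edge monomial [x y] involves only monomials divisible by
    [x y], and the support of such a monomial contains the edge. *)
Lemma edge_ideal_mcoeff (K : fieldType) (V : finType) (G : sgraph V)
    (p : {mpoly K[#|V|]}) (m : 'X_{1..#|V|}) :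
  p \in edge_ideal G -> stable G (mnm_exp m) -> p@_m = 0.
Proof.
move=> /asboolP[c ->] /stableP st.
rewrite raddf_sum big1 // => x _; rewrite raddf_sum big1 //= => y Gxy.
rewrite vvarM; apply: memN_msupp_eq0; rewrite (perm_mem (msuppMX _ _)).
apply/mapP => -[k _ mE]; have := st x y Gxy.
by rewrite /mnm_exp mE !mnmDE !mnm1E !eqxx => /(_ isT); rewrite addn1.
Qed.

(** Together with [edge_ideal_mcoeff], this makes the ideal the span of the
    monomials whose support contains an edge. *)
Lemma edge_ideal_mpolyX (K : fieldType) (V : finType) (G : sgraph V)
    (m : 'X_{1..#|V|}) :
  ~~ stable G (mnm_exp m) -> ('X_[m] : {mpoly K[#|V|]}) \in edge_ideal G.
Proof.
case/forallPn=> x /forallPn[y]; rewrite negb_imply => /andP[Gxy].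
rewrite negb_or => /andP[mx my].
(* Since loops are excluded, the two variables are distinct, so their product
   divides [m] as soon as each of them does. *)
have xy : enum_rank x != enum_rank y.
  by rewrite (inj_eq enum_rank_inj); apply: contraTneq Gxy => ->; rewrite adj_irr.
pose k := (U_(enum_rank x) + U_(enum_rank y))%MM.
have km : (k <= m)%MM.
  apply/mnm_lepP => i; rewrite mnmDE !mnm1E.
  have [<-|_] := eqVneq (enum_rank x) i; last first.
    by have [<-|_ //] := eqVneq (enum_rank y) i; rewrite lt0n.
  by rewrite eq_sym (negPf xy) lt0n.
apply/asboolP.
exists (fun u v => if (u == x) && (v == y) then 'X_[m - k] else 0).
rewrite (bigD1 x) //= (bigD1 y) //= !eqxx vvarM -mpolyXD submK //.
rewrite !big1 ?addr0 // => [u /negPf ux|v /andP[_ /negPf ->]].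
  by rewrite big1 // => v _; rewrite ux mul0r.
by rewrite mul0r.
Qed.

(** * Hilbert function as a number of monomials *)

Lemma dim_free_family (K : fieldType) (M : vectType K) (I : finType)
    (v : I -> M) :
  (forall x, exists c : I -> K, x = \sum_i c i *: v i) ->
  (forall c : I -> K, \sum_i c i *: v i = 0 -> forall i, c i = 0) ->
  \dim {:M} = #|I|.
Proof.
move=> span_v free_v; pose X := [tuple v (enum_val i) | i < #|I|].
have sumX (c : 'I_#|I| -> K) :
    \sum_i c i *: X`_i = \sum_i c (enum_rank i) *: v i.
  rewrite [RHS](reindex (@enum_val I (mem I))) /=; last first.
    by apply: onW_bij; apply: enum_val_bij.
  by apply: eq_bigr => i _; rewrite nth_mktuple enum_valK.
suff: basis_of fullv X by apply: vector.size_basis.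
apply/andP; split; last first.
  apply/freeP => c; rewrite sumX => /free_v c0 i.
  by rewrite -[i]enum_valK; apply: c0.
rewrite eqEsubv subvf; apply/subvP => x _.
have [c ->] := span_v x; apply: memv_suml => i _; apply: memvZ.
by apply: memv_span; apply/tnthP; exists (enum_rank i);
  rewrite tnth_mktuple enum_rankK.
Qed.

(** An exponent vector of total degree [d] has entries at most [d]; the bound
    makes the set finite. *)
Definition stable_exps {V : finType} (G : sgraph V) (d : nat) :
    {set {ffun V -> 'I_d.+1}} :=
  [set a : {ffun V -> 'I_d.+1} |
    (\sum_x a x == d)%N & stable G (fun x => a x)].

Lemma card_stable_mnm (V : finType) (G : sgraph V) (d : nat) :
  #|[set m : 'X_{1..#|V| < d.+1} | (mdeg m == d) & stable G (mnm_exp m)]|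
  = #|stable_exps G d|.
Proof.
pose f (m : 'X_{1..#|V| < d.+1}) : {ffun V -> 'I_d.+1} :=
  [ffun x => inord (mnm_exp m x)].
have fE m x : f m x = mnm_exp m x :> nat.
  rewrite ffunE inordK // (leq_ltn_trans _ (bmdeg m)) // mdegE.
  by rewrite (bigD1 (enum_rank x)) //= leq_addr.
have f_inj : injective f.
  move=> m1 m2 e; apply: val_inj; apply/mnmP => i.
  by have := fE m1 (enum_val i); rewrite e fE /mnm_exp enum_valK.
have stE (a b : V -> nat) : a =1 b -> stable G a = stable G b.
  by move=> /funext ->.
rewrite -(card_imset _ f_inj); apply: eq_card => a; rewrite !inE.
apply/imsetP/andP => [[m]|[/eqP da sta]].
  rewrite inE => /andP[/eqP dm stm] ->; split; last by rewrite (stE _ _ (fE m)).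
  by apply/eqP; under eq_bigr do rewrite fE; rewrite -mdeg_mnm_exp.
pose m := [multinom (a (enum_val i) : nat) | i < #|V|].
have mE : mnm_exp m =1 (fun x => a x).
  by move=> x; rewrite /mnm_exp mnmE enum_rankK.
have dm : mdeg m = d.
  by rewrite mdeg_mnm_exp -{}da; apply: eq_bigr => x _; rewrite mE.
have dm' : (mdeg m < d.+1)%N by rewrite dm.
exists (BMultinom dm'); first by rewrite inE /= dm eqxx (stE _ _ mE).
by apply/ffunP => x; apply: val_inj; rewrite /= fE /= mE.
Qed.

(** The basis consists of the classes of the monomials in [A]. They span since
    the other monomials of degree [d] vanish in the edge ring. They are free
    since an element of the ideal has coefficient 0 at each of them. *)
Lemma hilbert_function (K : fieldType) (V : finType) (G : sgraph V) (d : nat) :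
  \dim {:edge_comp K G d} = #|stable_exps G d|.
Proof.
rewrite -card_stable_mnm; set A := [set m | _ & _].
pose I : finType := {m | m \in A}.
have IP (i : I) : mdeg (val i) = d /\ stable G (mnm_exp (val i)).
  by have := valP i; rewrite inE => /andP[/eqP].
have w_homog (i : I) :
    edge_pi G ('X_[val i] : {mpoly K[#|V|]}) \in edge_homog d.
  apply/asboolP; exists 'X_[val i] => //.
  by rewrite dhomogX; apply/eqP; exact: (IP i).1.
transitivity #|I|; last by rewrite card_sig; apply: eq_card.
have sumE (c : I -> K) : \val (\sum_i c i *: EdgeComp (w_homog i)) =
    edge_pi G (\sum_i c i *: 'X_[val i]).
  rewrite !raddf_sum /=.
  by apply: eq_bigr => i _ /=; rewrite linearZ.
apply: (@dim_free_family _ _ _ (fun i => EdgeComp (w_homog i))).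
- move=> -[a ha]; have /asboolP[p hp ap] := ha.
  exists (fun i : I => p@_(val i)); apply: val_inj; rewrite [RHS]sumE /= ap.
  have /mpolywE pE : (msize p <= d.+1)%N.
    rewrite msizeE; apply/bigmax_leqP_seq => m mp _.
    by rewrite ltnS (dhomog_mf hp mp).
  rewrite {1}pE !raddf_sum (bigID (mem A)) /= [X in _ + X]big1 ?addr0.
    by rewrite big_sub.
  move=> m; rewrite inE negb_and => /orP[dm|stm].
    by rewrite (dhomog_nemf_coeff hp dm) scale0r raddf0.
  rewrite linearZ /=.
  suff /eqP -> : edge_pi G 'X_[K, m] == 0 by rewrite scaler0.
  by rewrite edge_pi_eq0 edge_ideal_mpolyX.
- move=> c /(congr1 val); rewrite sumE => /eqP.
  rewrite edge_pi_eq0 => sum_ideal i.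
  have := edge_ideal_mcoeff _ _ _ _ _ sum_ideal (IP i).2.
  rewrite raddf_sum (bigD1 i) //= mcoeffZ mcoeffX eqxx mulr1 big1 ?addr0 //.
  move=> j ji; rewrite mcoeffZ mcoeffX; case: eqP; rewrite ?mulr0 //.
  by move=> /val_inj/val_inj e; rewrite e eqxx in ji.
Qed.

(** * Counting in a join of graphs *)

Lemma stable_exps0 (V : finType) (G : sgraph V) : #|stable_exps G 0| = 1%N.
Proof.
rewrite -[RHS](cards1 ([ffun=> ord0] : {ffun V -> 'I_1})); apply: eq_card => a.
have -> : a = [ffun=> ord0] by apply/ffunP => x; rewrite [a x]ord1 ffunE.
rewrite !inE eqxx big1 => [|x _]; last by rewrite ffunE.
by apply/stableP => x y _; rewrite ffunE.
Qed.

(** Extension by zero embeds the stable exponent vectors of both factors, and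
    every vector arises in this way: one nonzero entry in [V] kills all entries
    in [W]. Both images contain the zero vector when [d = 0], so the union is
    disjoint only in positive degree. *)
Lemma card_stable_exps_gprod (V W : finType) (G : sgraph V) (H : sgraph W)
    (d : nat) : (0 < d)%N ->
  #|stable_exps (gprod G H) d| = (#|stable_exps G d| + #|stable_exps H d|)%N.
Proof.
move=> d_gt0.
pose extl (a : {ffun V -> 'I_d.+1}) : {ffun V + W -> 'I_d.+1} :=
  [ffun u => if u is inl x then a x else ord0].
pose extr (b : {ffun W -> 'I_d.+1}) : {ffun V + W -> 'I_d.+1} :=
  [ffun u => if u is inr x then b x else ord0].
have extlE a x : extl a (inl x) = a x by rewrite ffunE.
have extl0 a y : extl a (inr y) = ord0 by rewrite ffunE.
have extrE b y : extr b (inr y) = b y by rewrite ffunE.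
have extr0 b x : extr b (inl x) = ord0 by rewrite ffunE.
have extl_inj : injective extl.
  by move=> a a' e; apply/ffunP => x; rewrite -!extlE e.
have extr_inj : injective extr.
  by move=> b b' e; apply/ffunP => x; rewrite -!extrE e.
have extl_in a :
    (extl a \in stable_exps (gprod G H) d) = (a \in stable_exps G d).
  rewrite !inE big_sumType /= [X in (_ + X)%N]big1 ?addn0 => [|y _]; last first.
    by rewrite extl0.
  under eq_bigr do rewrite extlE.
  congr (_ && _); apply/stableP/stableP => st => [x y Gxy|].
    by have := st (inl x) (inl y) Gxy; rewrite !extlE.
  by move=> [x|x] [y|y] //=; rewrite ?extlE ?extl0 //; apply: st.
have extr_in b :
    (extr b \in stable_exps (gprod G H) d) = (b \in stable_exps H d).
  rewrite !inE big_sumType /= [X in (X + _)%N]big1 ?add0n => [|y _]; last first.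
    by rewrite extr0.
  under eq_bigr do rewrite extrE.
  congr (_ && _); apply/stableP/stableP => st => [x y Gxy|].
    by have := st (inr x) (inr y) Gxy; rewrite !extrE.
  by move=> [x|x] [y|y] //=; rewrite ?extrE ?extr0 //; apply: st.
rewrite -(card_imset _ extl_inj) -(card_imset (mem (stable_exps H d)) extr_inj).
rewrite -cardsUI [X in (_ + X)%N]eq_card0 ?addn0 => [|c]; last first.
  rewrite !inE; apply/andP => -[/imsetP[a Ga ->] /imsetP[b _ e]].
  move: Ga; rewrite -extl_in inE => /andP[+ _].
  rewrite big_sumType /= big1 => [|x _]; last by rewrite e extr0.
  rewrite big1 => [|y _]; last by rewrite extl0.
  by rewrite addn0 => /eqP d0; rewrite -d0 in d_gt0.
apply: eq_card => c; rewrite in_setU; apply/idP/orP => [cst|[]]; last first.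
- by case/imsetP => b ? ->; rewrite extr_in.
- by case/imsetP => a ? ->; rewrite extl_in.
have /stableP st : stable (gprod G H) (fun u => c u).
  by move: cst; rewrite inE => /andP[].
have [/existsP[x cx]|/existsPn c0] := boolP [exists x, c (inl x) != ord0].
  left; have cE : c = extl [ffun x => c (inl x)].
    apply/ffunP => -[x'|y]; rewrite ffunE ?ffunE //; apply: val_inj => /=.
    exact: (st (inl x)).
  by rewrite cE imset_f // -extl_in -cE.
right; have cE : c = extr [ffun y => c (inr y)].
  apply/ffunP => -[x|y]; rewrite ffunE ?ffunE //.
  by apply/eqP; have := c0 x; rewrite negbK.
by rewrite cE imset_f // -extr_in -cE.
Qed.

(** A nonzero entry kills all the others, so the whole degree is concentrated
    at one vertex. *)
Lemma card_stable_exps_complete (m d : nat) : (0 < d)%N ->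
  #|stable_exps (complete m) d| = m.
Proof.
move=> d_gt0; pose conc (w : 'I_m) : {ffun 'I_m -> 'I_d.+1} :=
  [ffun x => if x == w then ord_max else ord0].
have conc_inj : injective conc.
  move=> w w' /ffunP/(_ w); rewrite !ffunE eqxx.
  case: eqP => // _ /(congr1 val) /= d0.
  by rewrite d0 in d_gt0.
rewrite -[RHS]card_ord -(card_imset _ conc_inj).
apply: eq_card => a; rewrite !inE.
apply/andP/imsetP => [[/eqP da /stableP st]|[w _ ->]]; last first.
  split; last first.
    apply/stableP => x y xy; rewrite !ffunE.
    have [<- _|_] := eqVneq x w; last by rewrite eqxx.
    by rewrite eq_sym (negPf xy).
  rewrite (bigD1 w) //= ffunE eqxx big1 ?addn0 // => x /negPf xw.
  by rewrite ffunE xw.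
have [w aw] : exists w, a w != 0%N :> nat.
  apply/existsP; apply: contraTT d_gt0 => /existsPn a0.
  rewrite -da big1 // => x _.
  by apply/eqP; have := a0 x; rewrite negbK.
have a0 x : x != w -> a x = 0%N :> nat.
  by move=> xw; apply: (st w); rewrite //= /complete_rel eq_sym.
exists w => //; apply/ffunP => x; rewrite ffunE; apply: val_inj.
have [->|/a0 //] := eqVneq x w.
by rewrite /= -[RHS]da (bigD1 w) //= big1 ?addn0.
Qed.

(** * Hilbert series *)

Lemma fps_coef_natM (R : comNzRingType) (k : nat) (f : fps R) (n : nat) :
  fps_coef (k%:R * f) n = k%:R * fps_coef f n.
Proof.
rewrite !mulr_natl; elim: k => [|k IHk]; first by rewrite !mulr0n.
by rewrite !mulrS -IHk.
Qed.

Lemma fps_coef_XV1X (n : nat) :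
  fps_coef (fpsX / (1 - fpsX) : fps int) n = (0 < n)%N%:R.
Proof.
have -> : (1 - fpsX)^-1 = Fps (fun=> 1) :> fps int.
  by apply: (mulIr (unit_fps_1X _)); rewrite mulVr ?unit_fps_1X // geometric_fps.
by rewrite fpsXM; case: n.
Qed.

Theorem corollary1p6 (K : fieldType) (V : finType) (G : sgraph V) (m : nat) :
  hilbert_series K (gprod G (complete m)) =
  hilbert_series K G + m%:R * (fpsX / (1 - fpsX)).
Proof.
apply/fpsP => d.
rewrite -[RHS]/(fps_coef (hilbert_series K G) d +
  fps_coef (m%:R * (fpsX / (1 - fpsX))) d).
rewrite fps_coef_natM fps_coef_XV1X /= !hilbert_function.
have [->|d_gt0] := posnP d; first by rewrite !stable_exps0 mulr0 addr0.
rewrite card_stable_exps_gprod // card_stable_exps_complete // mulr1.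
by rewrite PoszD natz.
Qed.
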